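(* The collection of $\mathcal{H}$-visible compact subsets of $\mathbb{R}$ is dense in $\mathcal{C}(\mathbb{R})$.
   Context: $\mathcal{C}(\mathbb{R})$ is the space of all (nonempty) compact subsets of $\mathbb{R}$ with the Hausdorff metric. $\mathcal{H}$ is the set of all functions $h:[0,\infty)\to[0,\infty)$ that are continuous and nondecreasing with $h(0)=0$. For $h\in\mathcal{H}$, $\mu^h$ is the associated Hausdorff measure on the Borel subsets of $\mathbb{R}$: $\mu^h(A)=\lim_{\delta\to0}\inf\{\sum_i h(\mathrm{diam}(U_i)) : A\subseteq\bigcup_i U_i,\ \mathrm{diam}(U_i)\le\delta\}$ (countable covers). A Borel set $M\subseteq\mathbb{R}$ is $\mathcal{H}$-visible if there is $h\in\mathcal{H}$ with $0<\mu^h(M)<\infty$. *)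

(* Defs.v *)
From HB Require Import structures.
From mathcomp Require Import all_boot all_order all_algebra.
From mathcomp Require Import all_classical all_reals all_analysis.

Set Implicit Arguments.
Unset Strict Implicit.
Unset Printing Implicit Defensive.

Import Order.TTheory GRing.Theory Num.Theory.
Import numFieldNormedType.Exports.

Local Open Scope classical_set_scope.
Local Open Scope ring_scope.

Record compacts (R : realType) := Compacts {
  compacts_set :> set R ;
  compacts_compact : compact compacts_set ;
  compacts_nonempty : compacts_set !=set0
}.

HB.instance Definition _ (R : realType) := gen_eqMixin (compacts R).
HB.instance Definition _ (R : realType) := gen_choiceMixin (compacts R).

Section hausdorff_metric.
Context {R : realType}.
Implicit Types (A B C : set R) (K L M : compacts R).

Definition dist_to (x : R) A : R := inf [set `|x - a| | a in A].

Definition excess A B : R := sup [set dist_to x B | x in A].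

Definition hausdorff_dist K L : R := Num.max (excess K L) (excess L K).

Lemma compacts_eq K L : compacts_set K = compacts_set L -> K = L.
Proof.
case: K L => [K cK K0] [L cL L0] /= KL; subst L.
by congr Compacts; exact: Prop_irrelevance.
Qed.

Lemma dist_to_le x A a : A a -> dist_to x A <= `|x - a|.
Proof. by move=> Aa; apply: ge_inf; [exists 0 => _ [b _ <-] | exists a]. Qed.

Lemma le_dist_to x A r : A !=set0 -> (forall a, A a -> r <= `|x - a|) ->
  r <= dist_to x A.
Proof.
move=> [a Aa] Ar; apply: lb_le_inf; first by exists `|x - a|, a.
by move=> _ [b Ab <-]; exact: Ar.
Qed.

Lemma dist_to_le_excess K L x : compacts_set K x -> dist_to x L <= excess K L.
Proof.
move=> Kx; apply: ub_le_sup; last by exists x.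
have [b Lb] := compacts_nonempty L.
have [r [_ Kr]] := compact_bounded (@compacts_compact _ K).
exists (r + 1 + `|b|) => _ [y Ky <-].
apply: (le_trans (dist_to_le y Lb)); apply: (le_trans (ler_normB _ _)).
by rewrite lerD2r; apply: (Kr (r + 1)) => //; rewrite ltrDl.
Qed.

Lemma excess_le K L r :
  (forall x, compacts_set K x -> dist_to x L <= r) ->
  excess K L <= r.
Proof.
move=> Kr; have [x Kx] := compacts_nonempty K.
apply: ge_sup; first by exists (dist_to x L), x.
by move=> _ [y Ky <-]; exact: Kr.
Qed.

Lemma excess_triangle L K M : excess K M <= excess K L + excess L M.
Proof.
apply: excess_le => x Kx; rewrite -lerBlDr.
apply: le_trans (dist_to_le_excess L Kx).
apply: le_dist_to (compacts_nonempty L) _ => b Lb.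
rewrite lerBlDr addrC -lerBlDr; apply: le_trans (dist_to_le_excess M Lb).
apply: le_dist_to (compacts_nonempty M) _ => c Mc.
rewrite lerBlDr; apply: le_trans (dist_to_le _ Mc) _.
by rewrite [leRHS]addrC ler_distD.
Qed.

Lemma excess_le0 K L : excess K L <= 0 -> K `<=` L.
Proof.
move=> KL0 x Kx; have cL : closed L.
  exact: compact_closed (@Rhausdorff R) (@compacts_compact _ L).
apply: cL => V /nbhs_ballP[e /= e0 xeV].
apply: contrapT => LV0; suff : e <= 0 by rewrite leNgt e0.
rewrite (le_trans _ KL0)// (le_trans _ (dist_to_le_excess L Kx))//.
apply: le_dist_to (compacts_nonempty L) _ => b Lb.
by rewrite leNgt; apply/negP => xb; apply: LV0; exists b; split=> //; exact: xeV.
Qed.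

Lemma hausdorff_distxx K : hausdorff_dist K K = 0.
Proof.
rewrite /hausdorff_dist maxxx; apply/eqP; rewrite eq_le; apply/andP; split.
  by apply: excess_le => x Kx; rewrite (le_trans (dist_to_le _ Kx))// subrr normr0.
have [x Kx] := compacts_nonempty K.
rewrite (le_trans _ (dist_to_le_excess K Kx))//.
exact: le_dist_to (compacts_nonempty K) _.
Qed.

Lemma hausdorff_dist_positivity K L : hausdorff_dist K L = 0 -> K = L.
Proof.
move=> KL0; have : hausdorff_dist K L <= 0 by rewrite KL0.
rewrite ge_max => /andP[KL LK].
by apply: compacts_eq; apply/seteqP; split; exact: excess_le0.
Qed.

Lemma hausdorff_dist_sym K L : hausdorff_dist K L = hausdorff_dist L K.
Proof. exact: maxC. Qed.

Lemma hausdorff_dist_triangle L K M :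
  hausdorff_dist K M <= hausdorff_dist K L + hausdorff_dist L M.
Proof.
rewrite ge_max (le_trans (excess_triangle L K M)) ?lerD ?le_max ?lexx//=.
rewrite (le_trans (excess_triangle L M K))// addrC.
by rewrite lerD ?le_max ?lexx ?orbT.
Qed.

HB.instance Definition _ := isMetric.Build R (compacts R)
  hausdorff_distxx hausdorff_dist_positivity hausdorff_dist_sym
  hausdorff_dist_triangle.

End hausdorff_metric.

Section hausdorff_measure.
Context {R : realType}.
Implicit Types (h : R -> R) (A U : set R).

(* A function [0, +oo[ -> [0, +oo[ is represented by a total function R -> R
   whose values at negative arguments are never used. *)
Definition gauge h :=
  [/\ {within `[0, +oo[, continuous h},
      {in `[0, +oo[ &, nondecreasing_fun h},
      (forall t, 0 <= t -> 0 <= h t) &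
      h 0 = 0].

Local Open Scope ereal_scope.

(* Adjoining 0 only matters for the empty set: it makes diam set0 = 0. *)
Definition diam U : \bar R :=
  ereal_sup (0 |` [set (`|x - y|)%:E | x in U & y in U]).

Definition delta_cover A (delta : R) : set ((set R)^nat) :=
  [set U | A `<=` \bigcup_i U i /\ forall i, diam (U i) <= delta%:E].

(* [fine] is harmless here: the diameters in a delta-cover are finite. *)
Definition hausdorff_content h (delta : R) A : \bar R :=
  ereal_inf [set \sum_(i <oo) (h (fine (diam (U i))))%:E
            | U in delta_cover A delta].

Definition hausdorff_measure h A : \bar R :=
  lim (hausdorff_content h delta A @[delta --> 0^'+]).

Definition visible A :=
  measurable A /\
  exists2 h, gauge h & 0 < hausdorff_measure h A < +oo.

End hausdorff_measure.

(* Main.v *)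
Require Import Defs.
From mathcomp Require Import all_boot all_order all_algebra.
From mathcomp Require Import all_classical all_reals all_analysis.
From mathcomp Require Import lra.

(* With the gauge h(t) = t, every compact set of positive Lebesgue measure is
   visible: covering it by n equal intervals bounds its Hausdorff measure from
   above, and since a set of diameter d lies in an interval of length 2d, half
   of its Lebesgue measure is a bound from below. The closed e-neighbourhood of
   a compact set K is such a set, at Hausdorff distance at most e from K. *)

Set Implicit Arguments.
Unset Strict Implicit.
Unset Printing Implicit Defensive.

Import Order.TTheory GRing.Theory Num.Theory.
Import numFieldNormedType.Exports.

Local Open Scope classical_set_scope.
Local Open Scope ring_scope.

Section identity_gauge.
Context {R : realType}.
Implicit Types (A U : set R).

Lemma gauge_id : gauge (@idfun R).
Proof.
split => //.
by apply: continuous_subspaceT => x; exact: cvg_id.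
Qed.

Local Open Scope ereal_scope.

Lemma diam_ge0 U : 0 <= diam U.
Proof. by apply: ereal_sup_ubound; left. Qed.

Lemma le_diam U x y : U x -> U y -> `|x - y|%R%:E <= diam U.
Proof. by move=> Ux Uy; apply: ereal_sup_ubound; right; exists x => //; exists y. Qed.

Lemma diam_le U (r : R) : (0 <= r)%R ->
  (forall x y, U x -> U y -> (`|x - y| <= r)%R) -> diam U <= r%:E.
Proof.
move=> r0 Ur; apply: ge_ereal_sup => _ [->|[x Ux [y Uy <-]]]; rewrite lee_fin//.
exact: Ur.
Qed.

Lemma diam_fin_num U (r : R) : diam U <= r%:E -> diam U \is a fin_num.
Proof.
by move=> Ur; rewrite ge0_fin_numE ?diam_ge0// (le_lt_trans Ur) ?ltry.
Qed.

Lemma diam_set0 : diam (@set0 R) = 0.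
Proof. by apply/eqP; rewrite eq_le diam_ge0 andbT; apply: diam_le. Qed.

(** [U] itself need not be measurable, hence the passage to an interval [V]. Centring it at an
    arbitrary point of [U] costs a factor 2, which is harmless since only positivity is at stake. *)
Lemma measurable_cover_diam U : diam U \is a fin_num ->
  exists V : set R, [/\ measurable V, U `<=` V &
    lebesgue_measure V <= 2%:E * diam U].
Proof.
move=> Ufin; have [->|/set0P[x Ux]] := eqVneq U set0.
  by exists set0; split => //; rewrite measure0 mule_ge0 ?diam_ge0.
have d0 : (0 <= fine (diam U))%R by rewrite fine_ge0 ?diam_ge0.
exists `[(x - fine (diam U))%R, (x + fine (diam U))%R]%classic; split => //.
- move=> y Uy /=; rewrite in_itv/= -ler_distlC.
  by rewrite -lee_fin fineK// le_diam.
- rewrite lebesgue_measure_itv/=; case: ifP => _; last first.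
    by rewrite mule_ge0 ?diam_ge0.
  rewrite -[diam U in leRHS]fineK// -EFinB -EFinM lee_fin.
  lra.
Qed.

(** Countable subadditivity, applied to the intervals that enclose the members of a cover. The bound
    does not depend on [delta], so it passes to the limit. *)
Lemma content_id_ge A (delta : R) : measurable A ->
  lebesgue_measure A <= 2%:E * hausdorff_content idfun delta A.
Proof.
move=> mA; rewrite muleC -lee_pdivrMr//; apply: le_ereal_inf_tmp.
move=> _ [U [AU Ud] <-]; rewrite lee_pdivrMr// muleC.
have Ufin i : diam (U i) \is a fin_num by exact: diam_fin_num (Ud i).
have [V VP] := choice (fun i => measurable_cover_diam (Ufin i)).
apply: (@le_trans _ _ (\sum_(i <oo) lebesgue_measure (V i))).
  apply: measure_sigma_subadditive => //; first by move=> i; case: (VP i).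
  by apply: (subset_trans AU) => x [i _ Uix]; exists i => //; case: (VP i) => _ + _; apply.
rewrite -nneseriesZl; last by move=> i _; rewrite lee_fin fine_ge0 ?diam_ge0.
by apply: lee_nneseries => // i _; rewrite fineK//; case: (VP i).
Qed.

Lemma content_id_le (a b delta : R) A : (0 < delta)%R -> (a < b)%R ->
  A `<=` `[a, b[ -> hausdorff_content idfun delta A <= (b - a)%:E.
Proof.
move=> delta0 ab Aab.
have ba0 : (0 < b - a)%R by rewrite subr_gt0.
(* The successor makes [n] exceed [(b - a) / delta], so that the step [s] is at most [delta]. *)
pose n := (Num.truncn ((b - a) / delta)).+1.
pose s := ((b - a) / n%:R)%R.
have n0 : (0 < n%:R :> R)%R by rewrite ltr0n.
have s0 : (0 < s)%R by rewrite divr_gt0.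
have sdelta : (s <= delta)%R.
  rewrite ler_pdivrMr// mulrC -ler_pdivrMr//.
  by apply/ltW; exact: Num.Theory.truncnS_gt.
pose U i : set R :=
  if (i < n)%N then `[(a + i%:R * s)%R, (a + i.+1%:R * s)%R]%classic else set0.
have Us i : diam (U i) <= s%:E.
  rewrite /U; case: ifP => _; last by rewrite diam_set0 lee_fin ltW.
  apply: diam_le; first exact: ltW.
  move=> x y /=; rewrite !in_itv/= -[i.+1]addn1 natrD mulrDl mul1r.
  move=> /andP[x1 x2] /andP[y1 y2]; rewrite ler_distl.
  by apply/andP; split; lra.
apply: (@le_trans _ _ (\sum_(i <oo) (fine (diam (U i)))%:E)).
  apply: ereal_inf_lbound; exists U => //; split; last first.
    by move=> i; rewrite (le_trans (Us i))// lee_fin.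
  move=> x /Aab/=; rewrite in_itv/= => /andP[ax xb].
  have xa0 : (0 <= (x - a) / s)%R by rewrite divr_ge0 ?subr_ge0// ltW.
  have /andP[k1 k2] := Num.Theory.truncn_itv xa0.
  (* [x] lies in the piece whose index is the integer part of [(x - a) / s]; the strict bound
     [x < b] is what gives [k < n]. *)
  set k := Num.truncn _ in k1 k2.
  have kn : (k < n)%N.
    rewrite -(ltr_nat R) (le_lt_trans k1)// ltr_pdivrMr//.
    by rewrite /s mulrC divfK ?gt_eqF// ltrD2r.
  exists k => //; rewrite /U kn/= in_itv/=.
  rewrite -lerBrDl -ler_pdivlMr// k1/=.
  by rewrite -lerBlDl -ler_pdivrMr// ltW.
(* The tail consists of empty sets, of diameter 0; the first [n] terms add up to at most
   [n * s = b - a]. *)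
rewrite (nneseries_split 0 n); last by move=> i _; rewrite lee_fin fine_ge0 ?diam_ge0.
rewrite add0n eseries0 ?adde0; last first.
  by move=> i ni _; rewrite /U ltnNge ni/= diam_set0.
apply: (@le_trans _ _ (\sum_(0 <= i < n) s%:E)).
  by apply: lee_sum => i _; rewrite fineK// (diam_fin_num (Us i)).
rewrite sumEFin lee_fin sumr_const_nat subn0 -mulr_natr.
by rewrite /s divfK ?gt_eqF.
Qed.

(** A smaller [delta] admits fewer covers, so the content is monotone in [delta] and has a limit in
    the extended reals. *)
Lemma cvg_hausdorff_content (h : R -> R) A :
  cvg (hausdorff_content h delta A @[delta --> 0%R^'+]).
Proof.
apply: nonincreasing_at_right_is_cvge; near=> e => d1 d2 _ _ d12.
apply: ereal_inf_le_tmp => _ [U [AU Ud] <-]; exists U => //; split => // i.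
by rewrite (le_trans (Ud i))// lee_fin.
Unshelve. all: by end_near. Qed.

Lemma visible_compact (K : set R) : compact K -> 0 < lebesgue_measure K ->
  visible K.
Proof.
move=> cK K0; have mK := measurable_realfun.compact_measurable cK.
split; first exact: mK.
exists idfun; first exact: gauge_id.
apply/andP; split.
  apply: (@lt_le_trans _ _ (lebesgue_measure K * 2^-1%:E)).
    by rewrite mule_gt0.
  apply: lime_ge; first exact: cvg_hausdorff_content.
  by near=> d; rewrite lee_pdivrMr// muleC content_id_ge.
have [M [_ MK]] := compact_bounded cK.
have {}MK := MK (`|M| + 1)%R.
(* One more than the bound [|M| + 1] on [K], because the interval in [content_id_le] is open on the
   right. *)
apply: (@le_lt_trans _ _ ((`|M| + 2) - (- (`|M| + 2)))%:E); last exact: ltry.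
apply: lime_le; first exact: cvg_hausdorff_content.
near=> d; apply: content_id_le; first by [].
  by rewrite gtrN// ltr_wpDl.
move=> x Kx /=; rewrite in_itv/=.
have : (`|x| <= `|M| + 1)%R.
  by apply: MK => //; rewrite (le_lt_trans (ler_norm _))// ltrDl.
rewrite ler_norml => /andP[]; lra.
Unshelve. all: by end_near. Qed.

End identity_gauge.

Section neighbourhood.
Context {R : realType} (e : R) (e0 : 0 < e) (K : compacts R).

(** The closed [e]-neighbourhood as a Minkowski sum: a continuous image of a compact product, hence
    compact. *)
Definition cnbhd : set R := [set p.1 + p.2 | p in K `*` `[- e, e]].

Lemma compact_cnbhd : compact cnbhd.
Proof.
apply: continuous_compact.
  apply: continuous_subspaceT => p.
  by apply: cvgD; [exact: cvg_fst|exact: cvg_snd].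
by apply: compact_setX; [exact: compacts_compact|exact: segment_compact].
Qed.

Lemma cnbhd_self x : compacts_set K x -> cnbhd x.
Proof.
move=> Kx; exists (x, 0); rewrite /= ?addr0//; split => //=.
by rewrite in_itv/= oppr_le0 ltW.
Qed.

Lemma cnbhd_nonempty : cnbhd !=set0.
Proof. by have [x Kx] := compacts_nonempty K; exists x; exact: cnbhd_self. Qed.

Definition thickening : compacts R := Compacts compact_cnbhd cnbhd_nonempty.

Lemma hausdorff_dist_thickening : hausdorff_dist K thickening <= e.
Proof.
rewrite ge_max; apply/andP; split; apply: excess_le => x.
  move=> Kx; rewrite (le_trans (@dist_to_le _ _ _ x _))//; first exact: cnbhd_self.
  by rewrite subrr normr0 ltW.
move=> [[a t] [/= Ka]]; rewrite in_itv/= => te <-.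
by rewrite (le_trans (dist_to_le _ Ka))// addrAC subrr add0r ler_norml.
Qed.

(** A single point of [K] already puts an interval of length [2 * e] inside the thickening. *)
Lemma visible_thickening : visible thickening.
Proof.
apply: visible_compact; first exact: compact_cnbhd.
have [x Kx] := compacts_nonempty K.
apply: (@lt_le_trans _ _ (lebesgue_measure `[x - e, x + e]%classic)).
  rewrite lebesgue_measure_itv/= !lte_fin ifT; last by rewrite ltrD2l gtrN.
  by rewrite -EFinD lte_fin opprB addrC subrKA addr_gt0.
apply: le_measure; rewrite ?inE//; first exact: measurable_realfun.compact_measurable compact_cnbhd.
move=> y /=; rewrite in_itv/= => /andP[y1 y2].
exists (x, y - x); rewrite /= ?subrKC//; split => //=.
by rewrite in_itv/=; apply/andP; split; lra.
Qed.

End neighbourhood.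

Theorem corollary3p5 (R : realType) : dense [set K : compacts R | visible K].
Proof.
move=> O [K OK] oO.
have /nbhs_ballP[e /= e0 KeO] : nbhs K O by exact: open_nbhs_nbhs.
(* Halving turns the bound on the Hausdorff distance into the strict one that the ball requires. *)
have e20 : 0 < e / 2 by rewrite divr_gt0.
exists (thickening e20 K); split; last exact: visible_thickening.
apply: KeO; apply: (le_lt_trans (hausdorff_dist_thickening e20 K)).
by rewrite ltr_pdivrMr// ltr_pMr// ltr1n.
Qed.
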